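(* Every two-edge connected $C_{\geq 5}$-free finite simple graph is either all-round or bipartite all-round.
   Context: For a graph $G=(V,E)$ and $f\colon V\to\{0,1,2,3\}$, a connected mod-4 $f$-factor is a vector $\mathbf{x}\in\{0,1,2,3\}^E$ with $\sum_{e\in\delta(v)}x_e\equiv f(v)\pmod 4$ for all $v\in V$ ($\delta(v)$ = edges incident to $v$) such that the graph $(V,\{e\in E\mid x_e>0\})$ is connected. $G$ is all-round if it has a connected mod-4 $f$-factor for every $f\colon V\to\{0,1,2,3\}$ with $\sum_{v\in V}f(v)$ even. A bipartite $G$ with bipartition classes $U,W$ is bipartite all-round if it has a connected mod-4 $f$-factor for every $f\colon V\to\{0,1,2,3\}$ with $\sum_{v\in U}f(v)\equiv\sum_{v\in W}f(v)\pmod 4$. A graph is $C_{\geq 5}$-free if it has no induced subgraph isomorphic to a cycle $C_k$ with $k\geq 5$ vertices. *)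

(* Defs.v *)
From mathcomp Require Import all_boot.

Set Implicit Arguments.
Unset Strict Implicit.
Unset Printing Implicit Defensive.

(* Finite simple graphs. *)
Record sgraph := SGraph {
  vertex :> finType;
  adj : rel vertex;
  adj_sym : symmetric adj;
  adj_irr : irreflexive adj
}.

Definition edges (G : sgraph) : {set {set G}} :=
  [set [set x; y] | x in G, y in G & adj x y].

(* Connectedness of the graph (V, F).  The null graph is not connected. *)
Definition connected_by (V : finType) (F : {set {set V}}) : Prop :=
  0 < #|V| /\
  forall x y : V, connect [rel u v | [set u; v] \in F] x y.

(* The one-vertex graph is allowed. *)
Definition two_edge_connected (G : sgraph) : Prop :=
  connected_by (edges G) /\
  forall e : {set G}, e \in edges G -> connected_by (edges G :\ e).

Section Induced.
Variables (G : sgraph) (S : {set G}).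

Definition induced_adj : rel {x : G | x \in S} :=
  [rel x y | adj (val x) (val y)].

Lemma induced_sym : symmetric induced_adj.
Proof. by move=> x y; apply: adj_sym. Qed.

Lemma induced_irr : irreflexive induced_adj.
Proof. by move=> x; apply: adj_irr. Qed.

Definition induced_subgraph : sgraph := SGraph induced_sym induced_irr.
End Induced.

Section Cycle.
Variable k : nat.

(* [ordS i] is [i + 1] modulo [k]; the condition [i != j] is only of use for
   [k = 1]. *)
Definition cycle_adj : rel 'I_k :=
  [rel i j | (i != j) && ((j == ordS i) || (i == ordS j))].

Lemma cycle_sym : symmetric cycle_adj.
Proof. by move=> i j; rewrite /cycle_adj /= eq_sym orbC. Qed.

Lemma cycle_irr : irreflexive cycle_adj.
Proof. by move=> i; rewrite /cycle_adj /= eqxx. Qed.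

(* This is the cycle C_k for [3 <= k]. *)
Definition cycle_graph : sgraph := SGraph cycle_sym cycle_irr.
End Cycle.

Definition isomorphic (G H : sgraph) : Prop :=
  exists2 h : G -> H, bijective h & forall x y : G, adj (h x) (h y) = adj x y.

Definition C_ge5_free (G : sgraph) : Prop :=
  forall (k : nat) (S : {set G}), 5 <= k ->
    ~ isomorphic (induced_subgraph S) (cycle_graph k).

(* A vector indexed by the edges is given as a function on all vertex sets, of
   which only the values on [edges G] are used. *)
Definition connected_mod4_factor (G : sgraph) (f : G -> 'I_4)
    (x : {set G} -> 'I_4) : Prop :=
  (forall v : G, \sum_(e in edges G | v \in e) x e = f v %[mod 4]) /\
  connected_by [set e in edges G | 0 < x e].

Definition all_round (G : sgraph) : Prop :=
  forall f : G -> 'I_4, ~~ odd (\sum_v f v) ->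
    exists x : {set G} -> 'I_4, connected_mod4_factor f x.

Definition bipartition (G : sgraph) (U W : {set G}) : Prop :=
  [/\ U :|: W = [set: G], [disjoint U & W] &
      forall x y : G, adj x y -> (x \in U) && (y \in W) || (x \in W) && (y \in U)].

(* The bipartition of a connected graph is unique up to swapping the classes,
   so that quantifying existentially or universally over it is the same. *)
Definition bipartite_all_round (G : sgraph) : Prop :=
  exists U W : {set G}, bipartition U W /\
    forall f : G -> 'I_4,
      \sum_(v in U) f v = \sum_(v in W) f v %[mod 4] ->
      exists x : {set G} -> 'I_4, connected_mod4_factor f x.

(* Main.v *)
(* Give the vertices weights w in Z/4, either constantly 2 or all equal to 1 or
   -1, and call a vertex set S round for w if every f with
   sum_{v in S} w(v) f(v) = 0 has a connected mod-4 factor inside S using only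
   edges uv with w(u) + w(v) = 0.  The weight 2 encodes all-round, the weights
   1 and -1 on the two classes encode bipartite all-round.

   A single vertex is round, and roundness is preserved by attaching an ear
   with one or two interior vertices, or a closed ear with three: the labels
   along the ear are determined by the first one, so there are four candidates
   (two if the weights are 1 and -1 and do not extend along the ear, in which
   case the new weight is 2), and some candidate has at most one zero on the
   ear.

   If S is not everything, two-edge-connectedness yields an ear.  If no ear has
   one or two interior vertices, a shortest ear closed up by a shortest path in
   S is an induced cycle, so its length is at most 4 and the ear is closed with
   three interior vertices.  Hence the whole vertex set is round; if its weights
   are 1 and -1 and some edge uv has w(u) + w(v) <> 0, a suitable label on that
   unused edge turns the weight into 2. *)
Require Import Defs.
From mathcomp Require Import all_boot all_algebra zify ring.

Set Implicit Arguments.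
Unset Strict Implicit.
Unset Printing Implicit Defensive.

Import GRing.Theory.
Local Open Scope ring_scope.

(** * Reachability and shortest paths in a finite relation *)

Lemma connect_invariant (T : finType) (e : rel T) (P : pred T) x y :
  (forall a b, P a -> e a b -> P b) -> P x -> connect e x y -> P y.
Proof.
move=> clP Px /connectP[p + ->]; elim: p x Px => //= a p IHp x Px /andP[xa pa].
exact: IHp (clP _ _ Px xa) pa.
Qed.

(** A shortest walk from [x] to a point of [A] other than [x] works: an earlier visit to [A] or a
    forward chord would shorten it. The start [x] may itself lie in [A]. *)
Lemma induced_path_to (T : finType) (e : rel T) (A : pred T) x y :
    connect e x y -> A y -> y != x ->
  exists p, [/\ path e x p, uniq (x :: p), A (last x p) && (p != [::]),
     forall i, (0 < i < size p)%N -> ~~ A (nth x (x :: p) i) &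
     forall i j, (i < j < size (x :: p))%N ->
       e (nth x (x :: p) i) (nth x (x :: p) j) -> j = i.+1].
Proof.
move=> /connectP[p0 p0P lp0] Ay yx.
pose Q n := [exists t : n.-tuple T,
  [&& path e x t, A (last x t) & last x t != x]].
have QE (p : seq T) : path e x p -> A (last x p) -> last x p != x -> Q (size p).
  by move=> h1 h2 h3; apply/existsP; exists (in_tuple p); rewrite h1 h2.
have exQ : exists n, Q n by exists (size p0); apply: QE; rewrite -?lp0.
case: (ex_minnP exQ) => m /existsP[t /and3P[tP At tx]] minm.
have szt : size t = m by rewrite size_tuple.
have {}minm (p : seq T) : path e x p -> A (last x p) -> last x p != x ->
  (m <= size p)%N by move=> *; apply: minm; apply: QE.
move: {+}(tval t) szt tP At tx => {t} p1 szp1.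
case/shortenP=> p pP up sub_p Al lx.
have szp : size p = m.
  apply/eqP; rewrite eqn_leq minm // andbT -szp1 uniq_leq_size //.
  by case/andP: up.
have nthl i : (i <= size p)%N -> nth x (x :: p) i = last x (take i p).
  case: i => [|i] li; first by rewrite take0.
  by rewrite /= (take_nth x) // last_rcons.
have px : p != [::] by case: (p) lx => //=; rewrite eqxx.
exists p; split=> //; first by rewrite Al.
  move=> i /andP[i0 ip]; apply/negP => Ai.
  have := minm (take i p); rewrite -nthl; last exact: ltnW.
  rewrite take_path // Ai size_take ip -szp => /(_ isT isT).
  case: i {Ai} i0 ip => // i _ ip /=.
  suff -> : nth x p i != x by move=> /(_ isT); rewrite leqNgt ip.
  case/andP: up => + _; apply: contraNneq => <-; by apply/mem_nth/ltnW.
move=> i j /andP[ij jp] eij; apply/eqP; rewrite eqn_leq ij andbT leqNgt.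
apply/negP => ij1; case: j ij jp eij ij1 => // j ij jp eij ij1 /=.
(* After the case split the chord ends at [nth x p j], position [j.+1] of [x :: p]. Following it
   gives [take i p ++ drop j p], which is shorter because [i < j]. *)
have dj : drop j p = nth x p j :: drop j.+1 p by rewrite (drop_nth x).
have ll : last x (take i p ++ drop j p) = last x p.
  by rewrite -[in RHS](cat_take_drop j p) !last_cat dj.
have := minm (take i p ++ drop j p); rewrite ll Al lx.
rewrite size_cat size_take size_drop -szp.
have -> : path e x (take i p ++ drop j p).
  rewrite cat_path take_path //= dj /= -nthl /= ?eij //;
      last by move: jp => /=; lia.
  by move: pP; rewrite -{1}(cat_take_drop j p) cat_path dj /= => /and3P[].
by move=> /(_ isT isT isT); case: ifP; move: jp => /=; lia.
Qed.

(** * Arithmetic in Z/4: choosing the labels along an ear *)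

Definition Z4s : seq 'Z_4 := [:: 0; 1; 2; 3].

Lemma mem_Z4s (a : 'Z_4) : a \in Z4s.
Proof. by case: a; case=> [|[|[|[|]]]]. Qed.

Lemma all_Z4s (P : pred 'Z_4) : all P Z4s -> forall a, P a.
Proof. by move=> /allP aP a; apply/aP/mem_Z4s. Qed.

(* In the three lemmas below, [k] and [k'] are the weights of the ends of the ear
   in [S], [c] is the weighted sum of the demands on [S], the [b]'s are the
   demands of the interior vertices, and [a], [b1 - a], ... are the labels along
   the ear.  The first alternative is the case where the weight extends along
   the ear; in the second one the new weight is [2], and [2 * c] is the sum of
   the doubled demands on [S] because the old weights are odd. *)
Lemma ear1_value (k k' c b : 'Z_4) :
    k != 0 ->
    (k' == k) && (c == k * b) || (k * k' == -1) && (2 * c + 2 * b == 0) ->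
  exists a, (c == k * a + k' * (b - a)) && ((a != 0) || (b - a != 0)).
Proof.
pose P a := (c == k * a + k' * (b - a)) && ((a != 0) || (b - a != 0)).
(* As a search through [Z4s] the goal is boolean, and a computation over all values of the
   parameters settles it. *)
move=> k0 kP; suff /hasP[a _ ?] : has P Z4s by exists a.
apply/implyP: kP; apply/implyP: k0; rewrite {}/P.
move: b; refine (all_Z4s _);
move: c; refine (all_Z4s _).
move: k'; refine (all_Z4s _); move: k; refine (all_Z4s _).
by vm_compute.
Qed.

Lemma ear2_value (k k' c b1 b2 : 'Z_4) :
    k != 0 ->
    (k' == - k) && (c == k * b1 - k * b2) ||
      (k * k' == 1) && (2 * c + 2 * b1 + 2 * b2 == 0) ->
  exists a, (c == k * a + k' * (b2 - (b1 - a))) &&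
    [|| (a != 0) && (b1 - a != 0), (a != 0) && (b2 - (b1 - a) != 0)
      | (b1 - a != 0) && (b2 - (b1 - a) != 0)].
Proof.
pose P a := (c == k * a + k' * (b2 - (b1 - a))) &&
    [|| (a != 0) && (b1 - a != 0), (a != 0) && (b2 - (b1 - a) != 0)
      | (b1 - a != 0) && (b2 - (b1 - a) != 0)].
move=> k0 kP; suff /hasP[a _ ?] : has P Z4s by exists a.
apply/implyP: kP; apply/implyP: k0; rewrite {}/P.
move: b2; refine (all_Z4s _); move: b1; refine (all_Z4s _);
move: c; refine (all_Z4s _).
move: k'; refine (all_Z4s _); move: k; refine (all_Z4s _).
by vm_compute.
Qed.

Lemma ear3_value (k c b1 b2 b3 : 'Z_4) :
    k != 0 -> c == k * b1 - k * b2 + k * b3 ->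
  exists a, (c == k * a + k * (b3 - (b2 - (b1 - a)))) &&
   (((a == 0)%R + (b1 - a == 0)%R + (b2 - (b1 - a) == 0)%R +
       (b3 - (b2 - (b1 - a)) == 0)%R)%N <= 1)%N.
Proof.
pose P a := (c == k * a + k * (b3 - (b2 - (b1 - a)))) &&
   (((a == 0)%R + (b1 - a == 0)%R + (b2 - (b1 - a) == 0)%R +
       (b3 - (b2 - (b1 - a)) == 0)%R)%N <= 1)%N.
move=> k0 kP; suff /hasP[a _ ?] : has P Z4s by exists a.
apply/implyP: kP; apply/implyP: k0; rewrite {}/P.
move: b3; refine (all_Z4s _).
move: b2; refine (all_Z4s _); move: b1; refine (all_Z4s _); move: c; refine (all_Z4s _).
move: k; refine (all_Z4s _).
by vm_compute.
Qed.

Lemma natr_Z4 (a : 'Z_4) : (a : nat)%:R = a. Proof. exact: natr_Zp. Qed.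

Lemma eq_mod4 m n : (m%:R == n%:R :> 'Z_4) = (m == n %[mod 4])%N.
Proof. by rewrite -val_eqE /= !val_Zp_nat. Qed.

Section Graph.
Variable G : sgraph.
Implicit Types (S T Q : {set G}) (w f : G -> 'Z_4) (x : G -> G -> 'Z_4).
Implicit Types (es : seq (G * G * 'Z_4)).

(** * Induced cycles given by vertex sequences *)

(** The isomorphism with [cycle_graph] sends a vertex to its index in [c]; symmetry of adjacency
    takes care of the pairs with [j < i]. *)
Lemma no_induced_cycle (v0 : G) (c : seq G) :
    C_ge5_free G -> uniq c -> (5 <= size c)%N ->
    (forall i j, (i < j < size c)%N -> adj (nth v0 c i) (nth v0 c j) =
       (j == i.+1) || (i == 0%N) && (j == (size c).-1)) ->
  False.
Proof.
move=> CF uc c5 adjc; apply: (CF (size c) [set v in c]) => //.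
have idx (v : {v | v \in [set v in c]}) : (index (val v) c < size c)%N.
  by rewrite index_mem; have := valP v; rewrite inE.
pose h (v : induced_subgraph [set v in c]) : cycle_graph (size c) :=
  Ordinal (idx v).
have mem_c (i : 'I_(size c)) : nth v0 c i \in [set v in c].
  by rewrite inE mem_nth.
pose g (i : cycle_graph (size c)) : induced_subgraph [set v in c] :=
  exist _ (nth v0 c i) (mem_c i).
have hg : cancel g h by move=> i; apply: val_inj; rewrite /= index_uniq.
have gh : cancel h g.
  by move=> v; apply: val_inj; rewrite /= nth_index //;
    have := valP v; rewrite inE.
exists h; first by exists g.
have main (i j : 'I_(size c)) : (i < j)%N ->
  @cycle_adj (size c) i j = @adj G (nth v0 c i) (nth v0 c j).
  move=> ij; rewrite adjc ?ij ?ltn_ord //= /cycle_adj /=.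
  have -> : i != j by apply/eqP => ei; rewrite ei ltnn in ij.
  rewrite -!val_eqE /= (@modn_small i.+1); last exact: leq_trans (ltn_ord j).
  congr (_ || _); have := ltn_ord j.
  (* At the last index [ordS] wraps around to 0, which gives the closing edge of the cycle. *)
  have [->|jl] := eqVneq (j : nat) (size c).-1.
    by rewrite prednK ?modnn; lia.
  by move=> jc; rewrite modn_small; lia.
move=> u v; rewrite -(gh u) -(gh v) !hg.
move: (h u) (h v) => i j.
change (@cycle_adj (size c) i j = @adj G (nth v0 c i) (nth v0 c j)).
case: (ltngtP i j) => [||/val_inj->]; first exact: main.
  move=> ji; rewrite -[RHS]adj_sym -main // [LHS](@cycle_sym (size c)) //.
by rewrite adj_irr /cycle_adj /= eqxx.
Qed.

(** Meant for an ear [a] outside a round set closed up by a path [b] inside it: in [a ++ b] the two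
    joining edges become the seam and the closing edge. *)
Lemma no_induced_cycle_cat (v0 : G) (a b : seq G) :
    C_ge5_free G -> uniq a -> uniq b -> (forall u, u \in a -> u \notin b) ->
    (5 <= size a + size b)%N -> a != [::] -> b != [::] ->
    (forall i j, (i < j < size a)%N ->
       adj (nth v0 a i) (nth v0 a j) = (j == i.+1)) ->
    (forall i j, (i < j < size b)%N ->
       adj (nth v0 b i) (nth v0 b j) = (j == i.+1)) ->
    (forall i j, (i < size a)%N -> (j < size b)%N ->
       adj (nth v0 a i) (nth v0 b j) =
       (i == (size a).-1) && (j == 0%N) || (i == 0%N) && (j == (size b).-1)) ->
  False.
Proof.
move=> CF ua ub ab sz a0 b0 aa bb abE.
have {a0}a0 : (0 < size a)%N by rewrite lt0n size_eq0.
have {b0}b0 : (0 < size b)%N by rewrite lt0n size_eq0.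
apply: (@no_induced_cycle v0 (a ++ b)); rewrite ?size_cat //.
  rewrite cat_uniq ua ub andbT; apply/hasPn => u ub'.
  by apply: contraL ub' => /ab.
move=> i j /andP[ij jl]; rewrite !nth_cat.
case: (ltnP i (size a)) => ia; case: (ltnP j (size a)) => ja.
- by rewrite aa ?ij //; lia.
- by rewrite abE //; lia.
- by lia.
- by rewrite bb; lia.
Qed.

(** * Labellings, weights and the extension of a labelling *)

(* Edge vectors are symmetric functions on pairs of vertices that vanish on
   nonadjacent pairs. *)
Definition labelling S w f x : Prop :=
  [/\ forall u v, x u v = x v u,
      forall u v, x u v != 0 ->
        [&& u \in S, v \in S, adj u v & w u + w v == 0],
      forall v, v \in S -> \sum_u x v u = f v &
      {in S &, forall u v, connect [rel a b | x a b != 0] u v}].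

Definition solvable S w : Prop :=
  forall f, \sum_(v in S) w v * f v = 0 -> exists x, labelling S w f x.

Definition weight w : Prop :=
  (forall v, w v = 2) \/ (forall v, w v = 1 \/ w v = -1).

Definition round S : Prop := exists2 w, weight w & solvable S w.

Definition edge_label (u v : G) (t : 'Z_4) (a b : G) : 'Z_4 :=
  t *+ ((a == u) && (b == v) || (a == v) && (b == u)).

Definition edge_labels es (a b : G) : 'Z_4 :=
  \sum_(z <- es) edge_label z.1.1 z.1.2 z.2 a b.

Lemma edge_labels_sym es a b : edge_labels es a b = edge_labels es b a.
Proof.
apply: eq_bigr => z _.
by rewrite /edge_label orbC (andbC (a == _)) (andbC (a == _)).
Qed.

Lemma edge_labelsP es a b : edge_labels es a b != 0 ->
  exists2 z, z \in es & (z.1 == (a, b)) || (z.1 == (b, a)).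
Proof.
move=> lab0; apply/hasP; apply: contra_neqT lab0 => /hasPn noz.
rewrite /edge_labels big_seq big1 // => z /noz; rewrite /edge_label.
case: z => [[u v] t] /=; rewrite !xpair_eqE !(eq_sym u) !(eq_sym v).
by rewrite (andbC (b == u)) => /negPf->; rewrite mulr0n.
Qed.

Lemma edge_label_row u v t a :
  u != v -> \sum_b edge_label u v t a b = t *+ (a == u) + t *+ (a == v).
Proof.
move=> uv; transitivity
  (\sum_b (t *+ ((a == u) && (b == v)) + t *+ ((a == v) && (b == u)))).
  apply: eq_bigr => b _; rewrite /edge_label -mulrnDr; congr (_ *+ _).
  by case: eqVneq => [->|]; rewrite ?(negPf uv) ?andbF ?addn0 ?orbF.
have one c d : \sum_b t *+ (c && (b == d)) = t *+ c.
  by rewrite (bigD1 d) //= eqxx andbT big1 ?addr0 // => i /negPf->;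
    rewrite andbF.
by rewrite big_split /= !one.
Qed.

Lemma weight_neq0 w v : weight w -> w v != 0.
Proof. by case=> /(_ v) => [->|[]->]. Qed.

(* The edges of [es] are unused by every labelling of [S] for [w], so adding their
   labels to such a labelling cannot destroy its connectedness. *)
Lemma solvable_extend S T w w' f es :
    solvable S w -> S \subset T ->
    {in S &, forall u v, w u + w v = 0 -> w' u + w' v = 0} ->
    {in es, forall z, [&& adj z.1.1 z.1.2, z.1.1 \in T, z.1.2 \in T,
       w' z.1.1 + w' z.1.2 == 0 &
       ~~ [&& z.1.1 \in S, z.1.2 \in S & w z.1.1 + w z.1.2 == 0]]} ->
    {in T :\: S, forall v,
      \sum_(z <- es) (z.2 *+ (v == z.1.1) + z.2 *+ (v == z.1.2)) = f v} ->
    {in T :\: S, forall v,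
      exists2 s, s \in S & connect [rel a b | edge_labels es a b != 0] v s} ->
    \sum_(v in S) w v * f v = \sum_(z <- es)
      (w z.1.1 *+ (z.1.1 \in S) + w z.1.2 *+ (z.1.2 \in S)) * z.2 ->
  exists x, labelling T w' f x.
Proof.
move=> sol ST ww' esP rowf conf sumf; pose y := edge_labels es.
have yrow v : \sum_u y v u =
    \sum_(z <- es) (z.2 *+ (v == z.1.1) + z.2 *+ (v == z.1.2)).
  rewrite exchange_big /= [LHS]big_seq [RHS]big_seq; apply: eq_bigr => z zes.
  rewrite edge_label_row //; case/and5P: (esP z zes) => + _ _ _ _.
  by apply: contraTneq => ->; rewrite adj_irr.
have yP u v : y u v != 0 -> [&& adj u v, u \in T, v \in T,
       w' u + w' v == 0 & ~~ [&& u \in S, v \in S & w u + w v == 0]].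
  case/edge_labelsP=> [[z t] zes /=] /orP[] /eqP zE;
    have := esP _ zes; rewrite zE //=.
  case/and5P=> h1 h2 h3 h4 h5; apply/and5P; split=> //; [by rewrite adj_sym| |].
    by rewrite addrC.
  by rewrite andbCA addrC.
(* The labels of [es] are fixed first; [S] is then solved for the remaining demands, whose weighted
   sum vanishes by [sumf]. *)
have [|x' [x'C x'S x'f x'con]] := sol (fun v => f v - \sum_u y v u).
  under eq_bigr do rewrite mulrBr.
  rewrite big_split /= sumrN sumf; apply/eqP; rewrite subr_eq0; apply/eqP.
  under [RHS]eq_bigr do rewrite yrow mulr_sumr.
  rewrite exchange_big /=; apply: eq_bigr => z _.
  have one t u : \sum_(v in S) w v * (t *+ (v == u)) = w u *+ (u \in S) * t.
    case: (boolP (u \in S)) => uS.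
      rewrite (bigD1 u) //= eqxx big1 ?addr0 // => i /andP[_ /negPf->].
      by rewrite mulr0n mulr0.
    rewrite mulr0n mul0r big1 // => i iS; case: eqVneq => [iu|_].
      by rewrite -iu iS in uS.
    by rewrite mulr0n mulr0.
  under [RHS]eq_bigr do rewrite mulrDr.
  by rewrite big_split /= !one mulrDl.
pose x u v := x' u v + y u v.
have xC u v : x u v = x v u by rewrite /x x'C [y u v]edge_labels_sym.
have xx' u v : x' u v != 0 -> x u v != 0.
  move=> x0; rewrite /x; have [->|/yP] := eqVneq (y u v) 0.
    by rewrite addr0.
  by have /and4P[-> -> _ ->] := x'S _ _ x0; rewrite !andbF.
exists x; split=> //.
- move=> u v; have [x0|/x'S/and4P[uS vS -> wuv] _] := eqVneq (x' u v) 0.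
    by rewrite /x x0 add0r => /yP /and5P[-> -> -> -> _].
  by rewrite !(subsetP ST) // ww' ?eqxx //; apply/eqP.
- move=> v vT; rewrite big_split /=; case: (boolP (v \in S)) => vS.
    by rewrite x'f // subrK.
  rewrite big1 ?add0r ?yrow ?rowf ?inE ?vS // => u _.
  by apply/eqP; apply: contraNT vS => /x'S /and4P[].
have toS u : u \in T -> exists2 s, s \in S & connect [rel a b | x a b != 0] u s.
  move=> uT; case: (boolP (u \in S)) => uS; first by exists u.
  have [|s sS] := conf u; first by rewrite inE uS.
  move=> con; exists s => //; apply: connect_sub con => a b /= yab.
  apply: connect1 => /=; rewrite /x.
  have [->|/xx'] := eqVneq (x' a b) 0; first by rewrite add0r.
  by [].
have xsym : connect_sym [rel a b | x a b != 0].
  by apply: sym_connect_sym => a b /=; rewrite xC.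
move=> u v /toS[s sS us] /toS[t tS vt]; apply: connect_trans us _.
rewrite xsym; apply: connect_trans vt _.
have := x'con t s tS sS; apply: connect_sub => a b /= /xx' ?; exact: connect1.
Qed.

(** * Single vertices and the three kinds of ears *)

(** Weight 1 forces the demand to be 0, which the empty labelling meets. Weight 2 would also admit
    the demand 2, which has no solution. *)
Lemma round1 (v : G) : round [set v].
Proof.
exists (fun _ => 1); first by right; left.
move=> f; rewrite big_set1 mul1r => fv; exists (fun _ _ => 0); split=> //.
- by move=> u /set1P ->; rewrite big1.
- by move=> u u' /set1P -> /set1P ->; apply: connect0.
Qed.

(** Decides whether the weight extends along an ear with one interior vertex; [weight_opp_or] does
    the same for two. *)
Lemma weight_eq_or (w : G -> 'Z_4) u v :
  weight w -> w u = w v \/ w u * w v = -1 /\ (forall a, w a = 1 \/ w a = -1).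
Proof.
case=> ww; first by left; rewrite !ww.
by case: (ww u) (ww v) => [->|->] [->|->]; [left|right|right|left];
  rewrite ?mul1r ?mulr1.
Qed.

Lemma weight_opp_or (w : G -> 'Z_4) u v :
  weight w -> w u = - w v \/ w u * w v = 1 /\ (forall a, w a = 1 \/ w a = -1).
Proof.
case=> ww; first by left; rewrite !ww; apply/eqP.
by case: (ww u) (ww v) => [->|->] [->|->];
  [right|left|left|right]; rewrite ?mulrNN ?mul1r ?mulr1 ?opprK.
Qed.

(** Doubling erases the signs, since 2 = -2 in Z/4; this is the passage from odd weights to the
    weight 2. *)
Lemma odd_weight_double (w : G -> 'Z_4) S f : (forall v, w v = 1 \/ w v = -1) ->
  2 * (\sum_(v in S) w v * f v) = \sum_(v in S) 2 * f v.
Proof.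
move=> ww; rewrite mulr_sumr; apply: eq_bigr => v _; rewrite mulrA.
by case: (ww v) => ->; congr (_ * _); apply/eqP.
Qed.

Lemma weight2 : weight (fun _ : G => 2). Proof. by left. Qed.

(** Extends [w] along an ear starting at [s] with alternating signs: [Q] holds the interior vertices
    at even distance from [s] along the ear. *)
Definition alternate S w s (Q : {set G}) v :=
  if v \in S then w v else if v \in Q then w s else - w s.

Lemma weight_alternate S w s (Q : {set G}) :
  weight w -> weight (alternate S w s Q).
Proof.
rewrite /alternate; case=> ww; [left|right] => v; rewrite ?ww.
  by case: ifP => // _; case: ifP => // _; apply/eqP.
case: ifP => // _; case: ifP => // _.
by case: (ww s) => ->; [right|left]; rewrite ?opprK.
Qed.

Lemma round_ear1 S (s s' p : G) :
    s \in S -> s' \in S -> s != s' -> p \notin S -> adj s p -> adj p s' ->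
  round S -> round (p |: S).
Proof.
move=> sS s'S ss' pS sp ps' [w wt sol].
have sNp : s != p by apply: contraNneq pS => <-.
have s'Np : s' != p by apply: contraNneq pS => <-.
(* [wval] supplies the hypothesis of [ear1_value] for either choice of the new weight, so that the
   labelling is built only once. *)
suff [w' wt' [ww' wsp wps' wval]] : exists2 w', weight w' &
    [/\ {in S &, forall u v, w u + w v = 0 -> w' u + w' v = 0},
     w' s + w' p = 0, w' p + w' s' = 0 &
     forall f, \sum_(v in p |: S) w' v * f v = 0 ->
       let c := \sum_(v in S) w v * f v in
       (w s' == w s) && (c == w s * f p) ||
         (w s * w s' == -1) && (2 * c + 2 * f p == 0)].
  exists w' => // f /wval.
  case/(ear1_value (weight_neq0 s wt)) => [a /andP[/eqP sumf a0]].
  have N := (eqxx, negPf pS, negPf sNp, negPf s'Np, negPf ss', eq_sym p s,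
             eq_sym p s', eq_sym s' s).
  apply: (solvable_extend (es := [:: (s, p, a); (p, s', f p - a)]) sol) => //.
  - exact: subsetUr.
  - by move=> z; rewrite !inE => /orP[] /eqP-> /=;
      rewrite ?inE !N ?sS ?s'S ?sp ?ps' ?wsp ?wps' !N ?orbT ?andbF.
  - move=> v; rewrite !inE => /andP[vS]; rewrite (negPf vS) orbF => /eqP->.
    by rewrite !big_cons big_nil /= !N !mulr1n !mulr0n !addr0 add0r addrC subrK.
  - move=> v; rewrite !inE => /andP[vS]; rewrite (negPf vS) orbF => /eqP->.
    by case/orP: a0 => a0; [exists s | exists s'] => //; apply: connect1 => /=;
      rewrite /edge_labels !big_cons big_nil /edge_label /= !N /=
        ?mulr1n ?mulr0n ?addr0 ?add0r.
  - rewrite sumf !big_cons big_nil /= sS s'S !N.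
    by rewrite ?mulr1n ?mulr0n ?addr0 ?add0r.
have [ws|[ws odd_w]] := weight_eq_or s s' wt.
  exists (alternate S w s set0); first exact: weight_alternate.
  rewrite /alternate sS s'S (negPf pS) !inE; split=> //.
  - by move=> u v -> ->.
  - exact: subrr.
  - by rewrite -ws addNr.
  move=> f; rewrite big_setU1 //= (negPf pS) inE => sumf.
  rewrite ws eqxx /=; apply/orP; left; move: sumf; rewrite mulNr addrC.
  move/eqP; rewrite subr_eq0 -ws => /eqP <-; apply/eqP.
  by apply: eq_bigr => v ->.
exists (fun=> 2); first exact: weight2.
split; [by move=> *; apply/eqP|exact/eqP|exact/eqP|].
move=> f; rewrite big_setU1 //= -(odd_weight_double _ _ odd_w) addrC => ->.
by rewrite ws !eqxx orbT.
Qed.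

(** The ends [s] and [s'] may coincide, in which case the ear closes up to a triangle. *)
Lemma round_ear2 S (s s' p q : G) :
    s \in S -> s' \in S -> p \notin S -> q \notin S ->
    adj s p -> adj p q -> adj q s' ->
  round S -> round (p |: (q |: S)).
Proof.
move=> sS s'S pS qS sp pq qs' [w wt sol].
have sNp : s != p by apply: contraNneq pS => <-.
have s'Np : s' != p by apply: contraNneq pS => <-.
have sNq : s != q by apply: contraNneq qS => <-.
have s'Nq : s' != q by apply: contraNneq qS => <-.
have pNq : p != q by apply: contraTneq pq => ->; rewrite adj_irr.
have pqS : p \notin q |: S by rewrite !inE negb_or pNq.
suff [w' wt' [ww' [wsp wpq wqs'] wval]] : exists2 w', weight w' &
    [/\ {in S &, forall u v, w u + w v = 0 -> w' u + w' v = 0},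
     [/\ w' s + w' p = 0, w' p + w' q = 0 & w' q + w' s' = 0] &
     forall f, \sum_(v in p |: (q |: S)) w' v * f v = 0 ->
       let c := \sum_(v in S) w v * f v in
       (w s' == - w s) && (c == w s * f p - w s * f q) ||
         (w s * w s' == 1) && (2 * c + 2 * f p + 2 * f q == 0)].
  exists w' => // f /wval.
  case/(ear2_value (weight_neq0 s wt)) => [a /andP[/eqP sumf a0]].
  have N := (eqxx, negPf pS, negPf qS, negPf sNp, negPf s'Np, negPf sNq,
             negPf s'Nq, negPf pNq, eq_sym p s, eq_sym p s', eq_sym q s,
             eq_sym q s', eq_sym q p).
  pose es := [:: (s, p, a); (p, q, f p - a); (q, s', f q - (f p - a))].

  have [Esp Epq Eqp Eqs'] : [/\ edge_labels es p s = a,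
      edge_labels es p q = f p - a, edge_labels es q p = f p - a &
      edge_labels es q s' = f q - (f p - a)].
    by split; rewrite /edge_labels !big_cons big_nil /edge_label /= !N /=
        ?mulr1n ?mulr0n ?addr0 ?add0r.
  have ends v : v \in (p |: (q |: S)) :\: S -> v = p \/ v = q.
    rewrite !inE => /andP[/negPf->]; rewrite orbF.
    by case/orP=> /eqP; [left|right].
  apply: (solvable_extend (es := es) sol) => //.
  - by rewrite setUA subsetUr.
  - by move=> z; rewrite !inE => /or3P[] /eqP-> /=;
      rewrite ?inE !N ?sS ?s'S ?sp ?pq ?qs' ?wsp ?wpq ?wqs' !N ?orbT ?andbF.
  - move=> v /ends[] ->; rewrite !big_cons big_nil /= !N !mulr1n !mulr0n;
      by rewrite ?(addr0, add0r) addrC subrK.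
  (* At most one of the three labels is zero, so [p] and [q] each reach an end of the ear in one
     direction or the other. *)
  - have /andP[c1 c2] :
        ((a != 0) || (f p - a != 0) && (f q - (f p - a) != 0)) &&
        ((f q - (f p - a) != 0) || (f p - a != 0) && (a != 0)).
      by move: a0; do 3 case: (_ == 0).
    move=> v /ends[] ->.
      case/orP: c1 => [?|/andP[? ?]]; [exists s|exists s'] => //.
        by apply: connect1; rewrite /= Esp.
      by apply: (connect_trans (y := q)); apply: connect1;
        rewrite /= ?Epq ?Eqs'.
    case/orP: c2 => [?|/andP[? ?]]; [exists s'|exists s] => //.
      by apply: connect1; rewrite /= Eqs'.
    by apply: (connect_trans (y := p)); apply: connect1; rewrite /= ?Eqp ?Esp.
  - rewrite sumf !big_cons big_nil /= sS s'S !N.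
    by rewrite ?mulr1n ?mulr0n ?addr0 ?add0r ?mul0r ?add0r.
have sumT w' f : \sum_(v in p |: (q |: S)) w' v * f v =
    w' p * f p + (w' q * f q + \sum_(v in S) w' v * f v).
  by rewrite !big_setU1.
have [ws|[ws odd_w]] := weight_opp_or s' s wt.
  exists (alternate S w s [set q]); first exact: weight_alternate.
  rewrite /alternate sS s'S (negPf pS) (negPf qS) !inE eqxx (negPf pNq).
  split=> //.
  - by move=> u v -> ->.
  - by rewrite ws subrr addNr.
  move=> f; rewrite sumT (negPf pS) (negPf qS) !inE eqxx (negPf pNq).
  rewrite (eq_bigr (fun v => w v * f v)) => [sumf|v ->] //.
  rewrite ws eqxx /=; apply/orP; left; rewrite -subr_eq0.
  by apply/eqP; rewrite -[RHS]sumf; ring.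
exists (fun=> 2); first exact: weight2.
split; [by move=> *; apply/eqP|by split; apply/eqP|].
move=> f; rewrite sumT -(odd_weight_double _ _ odd_w) => sumf.
rewrite (mulrC (w s) (w s')) ws eqxx /= -[X in _ || (X == 0)]addrA.
rewrite [X in _ || (X == 0)]addrC -addrA.
by rewrite sumf eqxx orbT.
Qed.

(** Around a cycle of length 4 the alternating weight always closes up, so no change to the weight 2
    occurs. *)
Lemma round_ear3 S (s p q r : G) :
    s \in S -> p \notin S -> q \notin S -> r \notin S -> p != r ->
    adj s p -> adj p q -> adj q r -> adj r s ->
  round S -> round (p |: (q |: (r |: S))).
Proof.
move=> sS pS qS rS pNr sp pq qr rs [w wt sol].
have sNp : s != p by apply: contraNneq pS => <-.
have sNq : s != q by apply: contraNneq qS => <-.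
have sNr : s != r by apply: contraNneq rS => <-.
have pNq : p != q by apply: contraTneq pq => ->; rewrite adj_irr.
have qNr : q != r by apply: contraTneq qr => ->; rewrite adj_irr.
have N := (eqxx, negPf pS, negPf qS, negPf rS, negPf sNp, negPf sNq,
           negPf sNr, negPf pNq, negPf pNr, negPf qNr, eq_sym p s, eq_sym q s,
           eq_sym r s, eq_sym q p, eq_sym r p, eq_sym r q).
exists (alternate S w s [set q]); first exact: weight_alternate.
move=> f; rewrite !big_setU1 ?inE ?N //= /alternate !inE !N.
rewrite (eq_bigr (fun v => w v * f v)) => [sumf|v ->] //.
have {sumf} : \sum_(v in S) w v * f v == w s * f p - w s * f q + w s * f r.
  rewrite -subr_eq0; apply/eqP; rewrite -[RHS]sumf; ring.
case/(ear3_value (weight_neq0 s wt)) => a /andP[/eqP sumf a0].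
pose b := f p - a; pose c := f q - b; pose d := f r - c.
rewrite -/b -/c -/d in sumf a0.
pose es := [:: (s, p, a); (p, q, b); (q, r, c); (r, s, d)].
have [Esp Epq Eqr Ers] : [/\ edge_labels es p s = a, edge_labels es p q = b,
    edge_labels es q r = c & edge_labels es r s = d].
  by split; rewrite /edge_labels !big_cons big_nil /edge_label /= !N /=
      ?mulr1n ?mulr0n ?addr0 ?add0r.
have [Eqp Erq] : edge_labels es q p = b /\ edge_labels es r q = c.
  by rewrite (edge_labels_sym es q) (edge_labels_sym es r).
have ends v : v \in (p |: (q |: (r |: S))) :\: S -> [\/ v = p, v = q | v = r].
  rewrite !inE => /andP[/negPf->]; rewrite orbF.
  by case/or3P=> /eqP; [constructor 1|constructor 2|constructor 3].
apply: (solvable_extend (es := es) sol) => //.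
- by rewrite !setUA subsetUr.
- by move=> u v -> ->.
- by move=> z; rewrite !inE => /or4P[] /eqP-> /=;
    rewrite ?inE !N ?sS ?sp ?pq ?qr ?rs /= ?subrr ?addNr ?eqxx ?orbT ?andbF.
- move=> v /ends[] ->; rewrite !big_cons big_nil /= !N !mulr1n !mulr0n;
    by rewrite ?(addr0, add0r) addrC subrK.
(* With at most one zero among the four labels, each interior vertex reaches [s] one way round. *)
- have /and3P[c1 c2 c3] : [&& (a != 0) || [&& b != 0, c != 0 & d != 0],
      (b != 0) && (a != 0) || (c != 0) && (d != 0) &
      (d != 0) || [&& c != 0, b != 0 & a != 0]].
    by move: a0; do 4 case: (_ == 0).
  move=> v /ends[] ->; exists s => //.
  + case/orP: c1 => [?|/and3P[? ? ?]]; first by apply: connect1; rewrite /= Esp.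
    apply: (connect_trans (y := q)); first by apply: connect1; rewrite /= Epq.
    by apply: (connect_trans (y := r)); apply: connect1; rewrite /= ?Eqr ?Ers.
  + case/orP: c2 => /andP[? ?].
      by apply: (connect_trans (y := p)); apply: connect1; rewrite /= ?Eqp ?Esp.
    by apply: (connect_trans (y := r)); apply: connect1; rewrite /= ?Eqr ?Ers.
  + case/orP: c3 => [?|/and3P[? ? ?]]; first by apply: connect1; rewrite /= Ers.
    apply: (connect_trans (y := q)); first by apply: connect1; rewrite /= Erq.
    by apply: (connect_trans (y := p)); apply: connect1; rewrite /= ?Eqp ?Esp.
- rewrite sumf !big_cons big_nil /= sS !N.
  by rewrite ?mulr1n ?mulr0n ?addr0 ?add0r ?mul0r ?add0r.
Qed.

(** * Enlarging a round set until it contains all vertices *)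

Lemma edge_set2 (u v : G) : ([set u; v] \in edges G) = adj u v.
Proof.
apply/imset2P/idP => [[a b _]|uv]; last by exists u v; rewrite ?inE.
rewrite inE => /andP[_ ab] E.
have /set2P uab : u \in [set a; b] by rewrite -E set21.
have /set2P bE : b \in [set u; v] by rewrite E set22.
have /set2P aE : a \in [set u; v] by rewrite E set21.
case: uab => ua; rewrite ua in aE bE *; move: ab.
  by case: bE => -> //; rewrite adj_irr.
by case: aE => ->; rewrite ?adj_irr // adj_sym.
Qed.

Lemma adj_neq (u v : G) : adj u v -> u != v.
Proof. by apply: contraTneq => ->; rewrite adj_irr. Qed.

Lemma crossing_edge S : connected_by (edges G) -> S != set0 -> S != setT ->
  exists s p : G, [/\ s \in S, p \notin S & adj s p].
Proof.
case=> _ con /set0Pn[u uS] ST.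
have /existsP[s /existsP[p /and3P[? ? ?]]] :
    [exists s, exists p, [&& s \in S, p \notin S & @adj G s p]];
  last by exists s, p.
apply: contraNT ST => /existsPn noedge; rewrite -subTset; apply/subsetP => v _.
apply: (connect_invariant (P := fun v => v \in S) _ uS (con u v)) => a b /= aS.
rewrite edge_set2 => ab; apply: contraT => bS.
by have /existsPn/(_ b) := noedge a; rewrite aS bS ab.
Qed.

Lemma proper_extension_round S :
    two_edge_connected G -> C_ge5_free G -> S != set0 -> S != setT ->
  round S -> exists2 T : {set G}, S \proper T & round T.
Proof.
move=> [con con2] CF S0 ST rS.
have properU1 (T : {set G}) p : S \subset T -> p \notin S -> S \proper p |: T.
  move=> sST pS; rewrite properE (subset_trans sST) ?subsetUr //.
  by apply/subsetPn; exists p; rewrite ?setU11.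
(* Look for an ear with one interior vertex; if there is none, every vertex outside [S] has at most
   one neighbour in [S]. *)
have [/existsP[s /existsP[s' /existsP[p]]]|no1] := boolP
  [exists s, exists s', exists p,
    [&& s \in S, s' \in S, s != s', p \notin S, @adj G s p & @adj G p s']].
  case/and5P=> sS s'S ss' pS /andP[sp ps'].
  by exists (p |: S); [exact: properU1 | exact: round_ear1 sp ps' rS].
have uniq_nbr s s' p : s \in S -> s' \in S -> p \notin S ->
    adj s p -> adj s' p -> s = s'.
  move=> sS s'S pS sp s'p; apply: contraNeq no1 => ss'.
  apply/existsP; exists s; apply/existsP; exists s'; apply/existsP; exists p.
  by rewrite sS s'S ss' pS sp adj_sym.
pose nbr p := [exists s in S, @adj G s p].
have [/existsP[p /existsP[q]]|no2] := boolP [exists p, exists q,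
    [&& p \notin S, q \notin S, @adj G p q, nbr p & nbr q]].
  case/and5P=> pS qS pq /exists_inP[s sS sp] /exists_inP[s' s'S s'q].
  exists (p |: (q |: S)); first by apply: properU1 => //; exact: subsetUr.
  by apply: round_ear2 rS => //;
    [exact: sS | exact: s'S | rewrite // adj_sym..].
have {no2} no2 p q : p \notin S -> q \notin S ->
    nbr p -> nbr q -> adj p q = false.
  move=> pS qS np nq; apply: contraNF no2 => pq.
  by apply/existsP; exists p; apply/existsP; exists q; rewrite pS qS pq np nq.
have [s [p [sS pS sp]]] := crossing_edge con S0 ST.
pose eO := [rel a b | [&& a \notin S, b \notin S & @adj G a b]].
pose eS := [rel a b | [&& a \in S, b \in S & @adj G a b]].
have np : nbr p by apply/exists_inP; exists s.
(* Otherwise [p] is the only vertex of its component outside [S] with a neighbour in [S], and [s] is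
   its only such neighbour. Then the edge between them is a bridge: once it is removed, no walk from
   [p] enters [S]. *)
have [q0 [pq0 nq0 q0p]] : exists q, [/\ connect eO p q, nbr q & q != p].
  have /existsP[q /and3P[? ? ?]] :
      [exists q, [&& connect eO p q, nbr q & q != p]];
    last by exists q.
  apply: contraT => /existsPn noq.
  have esp : [set s; p] \in edges G by rewrite edge_set2.
  have [_ /(_ p s) ps] := con2 _ esp.
  suff /andP[_] : (connect eO p s) && (s \notin S) by rewrite sS.
  apply: (connect_invariant
    (P := fun v => connect eO p v && (v \notin S)) _ _ ps);
    last by rewrite connect0.
  move=> a b /andP[pa aS]; rewrite /= !inE edge_set2 => /andP[abN ab].
  have bS : b \notin S.
    apply/negP => bS.
    have na : nbr a by apply/exists_inP; exists b; rewrite ?(adj_sym b).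
    have := noq a; rewrite pa na /= negbK => /eqP ap.
    rewrite {}ap in pa aS na abN ab.
    have := uniq_nbr _ _ _ bS sS pS; rewrite adj_sym => /(_ ab sp) bs.
    by rewrite bs setUC eqxx in abN.
  rewrite bS andbT; apply: connect_trans pa (connect1 _) => /=.
  by rewrite aS bS.
have [Q [Qpath Quniq /andP[nlast Q0] Qint Qind]] := induced_path_to pq0 nq0 q0p.
have outQ v : v \in p :: Q -> v \notin S.
  rewrite inE => /predU1P[->//|vQ].
  elim: Q p {pS sp np pq0 q0p Quniq nlast Q0 Qint Qind} Qpath vQ
    => //= a Q IHQ p.
  by case/andP=> /and3P[_ aS _] aQ /predU1P[->//|]; apply: IHQ aQ.
have szQ : (0 < size Q)%N by rewrite lt0n size_eq0.
have Qadj i : (i < size Q)%N -> adj (nth p (p :: Q) i) (nth p (p :: Q) i.+1).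
  by move=> iQ; have /pathP-/(_ p i iQ) := Qpath; rewrite /= => /and3P[].
have [q qlast] : exists q, q = last p Q by exists (last p Q).
have qE : q = nth p (p :: Q) (size Q) by rewrite nth_last.
rewrite -qlast in nlast.
have qS : q \notin S by apply: outQ; rewrite qlast mem_last.
have [s' s'S s'q] : exists2 s', s' \in S & adj s' q by apply/exists_inP.
(* [Q] omits the first interior vertex [p], so size 1 would mean an ear with two interior vertices,
   against [no2]. *)
have sz2 : (1 < size Q)%N.
  rewrite ltnNge; apply/negP => Q1.
  have {}Q1 : size Q = 1%N by apply/eqP; rewrite eqn_leq Q1.
  have E : nth p (p :: Q) 1 = q by rewrite qE Q1.
  by have := Qadj 0%N szQ; rewrite E no2.
have [R [Runiq RS Rlast Rind]] : exists R, [/\ uniq (s' :: R),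
    {subset s' :: R <= S}, last s' R = s &
    forall i j, (i < j < size (s' :: R))%N ->
      adj (nth s' (s' :: R) i) (nth s' (s' :: R) j) = (j == i.+1)].
  have [<-|ss'] := eqVneq s' s.
    exists [::]; split=> //; first by move=> v; rewrite inE => /eqP->.
    by move=> i [|j]; rewrite ?andbF.
  (* A round set is connected: a labelling for the zero demand already links all its vertices by
     edges inside [S]. *)
  case: rS => w _ /(_ (fun=> 0)) [];
    first by rewrite big1 // => v; rewrite mulr0.
  move=> x [_ xS _ xcon].
  have s's : connect eS s' s.
    apply: connect_sub (xcon _ _ s'S sS) => a b /= /xS /and4P[aS bS ab _].
    by apply: connect1; rewrite /= aS bS.
  have ends_s : pred2 s s' s by rewrite /= eqxx.
  rewrite eq_sym in ss'.
  have [R [Rpath Runiq /andP[Rl R0] _ Rind]] := induced_path_to s's ends_s ss'.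
  have RS : {subset s' :: R <= S}.
    move=> v; rewrite inE => /predU1P[->//|].
    elim: (R) (s') Rpath => //= a R' IHR b /andP[/and3P[_ aS _] aR].
    by case/predU1P=> [->//|]; apply: IHR aR.
  exists R; split=> //.
    case/pred2P: Rl => // /eqP; case: (R) R0 Runiq => // a R' _ /=.
    by case/andP=> /negP s'R _ /eqP lastR; case: s'R;
      rewrite -{1}lastR mem_last.
  move=> i j /andP[ij jR]; apply/idP/eqP => [aij|ji].
    by apply: Rind; rewrite ?ij //= aij !RS // mem_nth // (ltn_trans ij).
  move: jR; rewrite ji => iR.
  by have /pathP-/(_ s' i iR) := Rpath; rewrite /= => /and3P[].
have nbrQ i : (i < (size Q).+1)%N -> nbr (nth p (p :: Q) i) ->
    (i == 0%N) || (i == size Q).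
  move=> iQ; apply: contraTT; rewrite negb_or => /andP[i0 iQ']; apply: Qint.
  by rewrite lt0n i0 ltn_neqAle iQ'.
have [sz5|sz4] := leqP 5 (size (p :: Q) + size (s' :: R)).
  case: (no_induced_cycle_cat (v0 := p) CF Quniq Runiq _ sz5) => //.
  - by move=> v /outQ; apply: contra; apply: RS.
  - move=> i j /andP[ij jQ]; apply/idP/eqP => [aij|ji].
      by apply: Qind; rewrite ?ij //= aij !outQ // mem_nth // (ltn_trans ij).
    by move: jQ; rewrite ji => iQ; apply: Qadj.
  - move=> i j /andP[ij jR]; have iR := ltn_trans ij jR.
    by rewrite (set_nth_default s' p iR) (set_nth_default s' p jR) Rind ?ij.
  - move=> i j iQ jR; rewrite (set_nth_default s' p jR).
    have jS : nth s' (s' :: R) j \in S by rewrite RS ?mem_nth.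
    have iO : nth p (p :: Q) i \notin S by rewrite outQ ?mem_nth.
    have sE : s = nth s' (s' :: R) (size R) by rewrite nth_last.
    (* By [nbrQ] only the ends [p] and [q] of the ear have neighbours in [S], and by [uniq_nbr]
       these are just [s] and [s'], the ends of the path [s' :: R]. *)
    apply/idP/idP => [aij|].
      have /nbrQ/(_ _)/orP : (i < (size Q).+1)%N by [].
      case=> [|/eqP i0|/eqP iE];
        first by apply/exists_inP; exists (nth s' (s' :: R) j);
          rewrite // adj_sym.
        have := uniq_nbr _ _ _ jS sS iO; rewrite adj_sym {2}i0 => /(_ aij sp).
        rewrite sE => /eqP; rewrite nth_uniq // => /eqP->.
        by rewrite i0 !eqxx orbT.
      have := uniq_nbr _ _ _ jS s'S iO; rewrite adj_sym {2}iE -qE => /(_ aij s'q).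
      rewrite -[RHS]/(nth s' (s' :: R) 0) => /eqP.
      rewrite nth_uniq // => /eqP->.
      by rewrite iE !eqxx.
    case/orP=> /andP[/eqP-> /eqP->] /=.
      by rewrite -/(nth p (p :: Q) (size Q)) -qE adj_sym.
    by rewrite -/(nth s' (s' :: R) (size R)) -sE adj_sym.
(* At most four vertices in all, at least three of them on the ear, leave only [s' = s] and three
   interior vertices. *)
have RE : R = [::].
  by case: (R) sz4 sz2 => // u R' /=; clear; lia.
have [a [b QE]] : exists a b, Q = [:: a; b].
  rewrite RE in sz4; case: (Q) sz4 sz2 => [|a [|b [|c Q']]] //=;
    last by clear; lia.
  by exists a, b.
rewrite RE /= in Rlast; rewrite Rlast in s'q.
rewrite {}QE in Quniq outQ Qadj qE qlast.
have aS : a \notin S by rewrite outQ // !inE eqxx orbT.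
exists (p |: (a |: (b |: S))).
  by apply: properU1 => //; rewrite setUA subsetUr.
rewrite qlast /= in qS s'q.
apply: (round_ear3 (s := s)) rS => //; last by rewrite adj_sym.
- by move: Quniq => /=; rewrite !inE negb_or => /andP[/andP[]].
- exact: (Qadj 0%N).
- exact: (Qadj 1%N).
Qed.

Lemma round_setT : two_edge_connected G -> C_ge5_free G -> round [set: G].
Proof.
move=> con CF; have /card_gt0P[v _] : (0 < #|G|)%N by case: con => [[]].
have [n] := ubnP #|~: [set v]|; have := round1 v; have : [set v] != set0.
  by rewrite -card_gt0 cards1.
elim: n [set v] => // n IHn S S0 rS Sn.
have [<-//|ST] := eqVneq S [set: G].
have [T ST' rT] := proper_extension_round con CF S0 ST rS.
apply: (IHn T) => //.
  by apply: contraTneq ST' => ->; rewrite properE subset0 (negPf S0).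
by rewrite ltnS in Sn; apply: leq_trans Sn; rewrite proper_card // properC.
Qed.

(** * From weights to connected mod-4 factors *)

(** The demands for weight 2 make the old weighted sum 0 or 2. The ends of the bad edge have equal
    odd weights, adding up to 2, so a label 0 or 1 on it corrects the sum. *)
Lemma solvable2_of_bad_edge (w : G -> 'Z_4) (u v : G) :
    (forall a, w a = 1 \/ w a = -1) -> solvable [set: G] w ->
    adj u v -> w u + w v != 0 ->
  solvable [set: G] (fun=> 2).
Proof.
move=> odd_w sol uv wuv f; rewrite -(odd_weight_double _ _ odd_w) => sum0.
have wuv2 : w u + w v = 2.
  by case: (odd_w u) (odd_w v) wuv => [->|->] [->|->];
    rewrite ?subrr ?addNr ?eqxx // => _; apply/eqP.
have [t sumt] : exists t, \sum_(a in [set: G]) w a * f a = (w u + w v) * t.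
  rewrite wuv2; move: (\sum_(a in _) _) sum0 => c c0.
  have : [|| c == 0 | c == 2].
    move/eqP: c0; apply/implyP; move: c; refine (all_Z4s _).
    by vm_compute.
  by case/orP=> /eqP->; [exists 0|exists 1]; apply/eqP.
apply: (solvable_extend (es := [:: (u, v, t)]) sol) => //.
- by move=> *; apply/eqP.
- by move=> z; rewrite inE => /eqP->; rewrite !inE uv wuv2.
- by move=> a; rewrite setDT inE.
- by move=> a; rewrite setDT inE.
- by rewrite sumt big_cons big_nil !inE addr0.
Qed.

Lemma edges_at (v : G) :
  [set e in edges G | v \in e] = [set [set v; u] | u in [set u | adj v u]].
Proof.
apply/setP => e; rewrite inE; apply/andP/imsetP => [[]|[u]].
  case/imset2P=> a b _; rewrite inE => /andP[_ ab] -> /set2P[] ->.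
    by exists b; rewrite ?inE.
  by exists a; rewrite ?inE 1?setUC // adj_sym.
by rewrite inE => vu ->; rewrite edge_set2 set21.
Qed.

Lemma set2_inj (v : G) :
  {in [set u | adj v u] &, injective (fun u => [set v; u])}.
Proof.
move=> a b; rewrite !inE => va _ /setP/(_ a); rewrite !inE eqxx orbT.
by rewrite eq_sym (negPf (adj_neq va)) => /esym/eqP.
Qed.

Lemma labelling_factor w (f : G -> 'I_4) x :
    (0 < #|G|)%N -> labelling [set: G] w f x ->
  exists X : {set G} -> 'I_4, connected_mod4_factor f X.
Proof.
move=> G0 [xC xS xf xcon].
(* An edge is an unordered pair, so [pick] chooses an order of its ends; the symmetry of [x] makes
   the choice harmless. *)
pose X (e : {set G}) : 'I_4 :=
  if [pick p : G * G | e == [set p.1; p.2]] is Some p then x p.1 p.2 else 0.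
have XE u v : adj u v -> X [set u; v] = x u v.
  move=> uv; rewrite /X; case: pickP => [[a b] /= /eqP E|/(_ (u, v))];
    last by rewrite eqxx.
  have /set2P vab : v \in [set a; b] by rewrite -E set22.
  have /set2P uab : u \in [set a; b] by rewrite -E set21.
  by move: uv; case: uab vab => -> [] -> //; rewrite adj_irr.
exists X; split.
  move=> v; apply/eqP; rewrite -eq_mod4 natr_sum natr_Z4 -xf ?inE //; apply/eqP.
  rewrite -big_set /= edges_at big_imset /=; last exact: set2_inj.
  rewrite [RHS](bigID (adj v)) /= [X in _ + X]big1 ?addr0.
    by rewrite big_set; apply: eq_bigr => u vu; rewrite natr_Z4 XE.
  by move=> u; apply: contraNeq => /xS /and4P[].
split=> // u v; apply: connect_sub (xcon u v _ _); rewrite ?inE // => a b /= x0.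
apply: connect1 => /=; have /and4P[_ _ ab _] := xS _ _ x0.
by rewrite !inE edge_set2 ab XE // lt0n.
Qed.

End Graph.

Theorem theorem4p7 (G : sgraph) :
  two_edge_connected G -> C_ge5_free G ->
  all_round G \/ bipartite_all_round G.
Proof.
move=> con CF; have G0 : (0 < #|G|)%N by case: con => [[]].
(* For weight 2 the solvability condition says that twice the sum of the demands is 0 modulo 4, that
   is, the sum is even. *)
have allR : solvable [set: G] (fun=> 2) -> all_round G.
  move=> sol f evf; have [|x xP] := sol f; last exact: labelling_factor xP.
  rewrite -mulr_sumr [X in _ * X](eq_bigr (fun v => (f v : nat)%:R)); last first.
    by move=> v _; exact/esym/natr_Z4.
  under eq_bigl do rewrite inE.
  rewrite -natr_sum -(even_halfK evf) -natrM; apply/eqP.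
  by rewrite (eq_mod4 _ 0) -muln2 mulnCA -[(2 * 2)%N]/4%N modnMl.
have [w wt sol] := round_setT con CF.
case: wt => [w2|odd_w].
  left; apply: allR => f; rewrite (eq_bigr (fun v => w v * f v)) => [|v _];
    last by rewrite w2.
  case/sol=> x [xC xS xf xcon]; exists x; split=> // u v /xS /and4P[-> -> -> _].
  exact: isT.
have [/existsP[u /existsP[v /andP[uv wuv]]]|nobad] :=
  boolP [exists u, exists v, @adj G u v && (w u + w v != 0)].
  by left; apply/allR/(solvable2_of_bad_edge odd_w sol uv).
(* Every edge now joins opposite weights, so the level sets of [w] are the two classes, and the
   weighted sum is the difference of the class sums. *)
right; exists [set v | w v == 1], [set v | w v == -1]; split.
  have one_neq : 1 == -1 :> 'Z_4 = false by [].
  split.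
  - by apply/setP => v; rewrite !inE; case: (odd_w v) => ->.
  - rewrite -setI_eq0; apply/eqP/setP => v; rewrite !inE.
    by case: (odd_w v) => ->.
  - move=> u v uv; rewrite !inE.
    have : w u + w v == 0.
      apply: contraNT nobad => ?; apply/existsP; exists u; apply/existsP.
      by exists v; rewrite uv.
    by case: (odd_w u) (odd_w v) => [->|->] [->|->].
move=> f /eqP; rewrite -eq_mod4 !natr_sum => /eqP sumf.
have [|x xP] := sol f; last exact: labelling_factor xP.
under eq_bigl do rewrite inE.
rewrite (bigID (fun v => w v == 1)) /=; apply/eqP; rewrite addr_eq0; apply/eqP.
transitivity (\sum_(v in [set v | w v == 1]) (f v : nat)%:R : 'Z_4).
  rewrite big_set; apply: eq_bigr => v /eqP ->.
  by rewrite mul1r; exact/esym/natr_Z4.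
rewrite sumf -sumrN big_set; apply: eq_big => v.
  by rewrite unfold_in /=; case: (odd_w v) => ->.
by rewrite unfold_in /= => /eqP->; rewrite mulN1r opprK; exact: natr_Z4.
Qed.
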